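(* Let $G$ be a finite connected graph, $\Gamma=\mathbb{Z}_{N_1}\times\cdots\times\mathbb{Z}_{N_d}$ a finite abelian group of order $N$, and $\phi:V(G)\to\Gamma$ an isometric embedding of $G$ into a Cayley graph $\mathrm{Cay}(\Gamma,S)$. For all signals $s,t:V(G)\to\mathbb{C}$, $$\sum_{v\in V(G)}s(v)\overline{t(v)}=\sum_{k}\hat s(k)\overline{\hat t(k)},$$ where $\hat s,\hat t$ are the group-embedding graph Fourier transforms; in particular $\|s\|_2=\|\hat s\|_2$.
   Context: $\mathrm{Cay}(\Gamma,S)$ (with $S=-S\subseteq\Gamma\setminus\{0\}$ generating $\Gamma$) is the graph on $\Gamma$ with edges $\{g,g+s\}$; $\phi$ is isometric if it preserves shortest-path distances (so it is injective). For $k=(k_1,\dots,k_d)\in\Gamma$, the character $\chi_k$ is $\chi_k(g)=\prod_{j=1}^d e^{2\pi i k_jg_j/N_j}$. The lift of $s$ is $\tilde s:\Gamma\to\mathbb{C}$ with $\tilde s(\phi(v))=s(v)$ and $\tilde s=0$ off $\phi(V(G))$. The group-embedding graph Fourier transform is $\hat s(k)=\frac{1}{\sqrt N}\sum_{g\in\Gamma}\tilde s(g)\overline{\chi_k(g)}$ for $k\in\Gamma$ (indexing the dual group). *)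

(* Defs.v *)
From HB Require Import structures.
From mathcomp Require Import all_boot all_order all_algebra all_fingroup.
From mathcomp Require Import reals trigo.
From mathcomp Require Import complex.
Set Implicit Arguments. Unset Strict Implicit. Unset Printing Implicit Defensive.
Import Order.TTheory GRing.Theory Num.Theory.
Local Open Scope ring_scope.

(* A simple graph on a finite vertex set [V] is a symmetric irreflexive
   relation [e : rel V]. *)
Definition is_graph (V : finType) (e : rel V) : Prop :=
  symmetric e /\ irreflexive e.

Definition graph_connected (V : finType) (e : rel V) : Prop :=
  forall x y : V, connect e x y.

(* Shortest-path distance: the least length of an [e]-path from [x] to [y].
   Shortest paths have length < #|V|, so searching below #|V| is enough; the
   value is #|V| exactly when there is no path from [x] to [y]. *)
Definition gdist (V : finType) (e : rel V) (x y : V) : nat :=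
  find (fun n => [exists p : n.-tuple V, path e x p && (last x p == y)])
       (iota 0 #|V|).

Definition isometric (V W : finType) (e : rel V) (f : rel W) (phi : V -> W) :
    Prop :=
  forall u v : V, gdist f (phi u) (phi v) = gdist e u v.

(* The group Z/nZ for [0 < n]; ['Z_n] is not usable, as ['Z_1] has order 2. The
   group law [*%g] of this finGroupType is addition modulo [n]. *)
Definition Zmodn (n : nat) : finGroupType := 'I_n.-1.+1.

(* Z_{N_1} x ... x Z_{N_d}, with the direct product group law of [gproduct];
   it is thus written multiplicatively: [(g * s)%g], [1%g], [s^-1%g] stand for
   g + s, 0, -s. *)
Definition prodZ (d : nat) (N : 'I_d -> nat) : finGroupType :=
  {dffun forall j : 'I_d, Zmodn (N j)}.

Definition is_connection_set (gT : finGroupType) (S : {set gT}) : Prop :=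
  [/\ (S^-1)%g = S, 1%g \notin S & <<S>>%g = [set: gT]].

Definition cayley (gT : finGroupType) (S : {set gT}) : rel gT :=
  fun g h => [exists s in S, h == (g * s)%g].

Section Fourier.
Variable R : realType.

Definition cexpi (x : R) : R[i] := Complex (cos x) (sin x).

Section Group.
Variables (d : nat) (N : 'I_d -> nat).

Definition chi (k g : prodZ N) : R[i] :=
  \prod_(j < d)
    cexpi (2 * pi * (nat_of_ord (k j))%:R * (nat_of_ord (g j))%:R / (N j)%:R).

Variables (V : finType) (phi : V -> prodZ N).

Definition lift_signal (s : V -> R[i]) (g : prodZ N) : R[i] :=
  if [pick v | phi v == g] is Some v then s v else 0.

Definition gft (s : V -> R[i]) (k : prodZ N) : R[i] :=
  ((Num.sqrt #|prodZ N|%:R)^-1)%:C%C *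
    \sum_(g : prodZ N) lift_signal s g * (chi k g)^*.

End Group.

Definition l2norm (T : finType) (f : T -> R[i]) : R :=
  Num.sqrt (\sum_(x : T) Normc.normc (f x) ^+ 2).

End Fourier.

(* Main.v *)
(** An isometric [phi] is injective, since distance zero means equality; hence
    the lift [s |-> lift_signal phi s] preserves the Hermitian product.  The
    statement is then Parseval on the group, i.e. the orthogonality relation
    [\sum_k chi k g * (chi k h)^* = N (g == h)]: the summand is multiplicative
    in [k], and if [g] and [h] differ at the coordinate [j] it takes a value
    other than [1] at the [j]-th unit vector, so translating the sum by this
    vector shows that it vanishes. *)
Require Import Defs.
From mathcomp Require Import all_boot all_order all_algebra all_fingroup.
From mathcomp Require Import reals trigo complex.
Import Order.TTheory GRing.Theory Num.Theory.
Local Open Scope ring_scope.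

Lemma gdist_eq0 (V : finType) (e : rel V) (x y : V) :
  (gdist e x y == 0)%N = (x == y).
Proof.
(* As [V] is inhabited, the search starts at length [0], where the empty path is the only
   candidate. *)
have V0 : (0 < #|V|)%N by apply/card_gt0P; exists x.
rewrite /gdist -(prednK V0) /=; case: ifP => [/existsP[p]|].
  by rewrite (tuple0 p) => /= ->.
by move/negbT/existsPn/(_ [tuple]) => /= /negbTE ->.
Qed.

Lemma isometric_inj (V W : finType) (e : rel V) (f : rel W) (phi : V -> W) :
  isometric e f phi -> injective phi.
Proof.
by move=> isof u v /eqP; rewrite -(gdist_eq0 _ f) isof gdist_eq0 => /eqP.
Qed.

(** Reindexing by [x |-> a * x] multiplies the sum by [f a]. *)
Lemma sum_multiplicative_eq0 (gT : finGroupType) (F : fieldType)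
    (f : gT -> F) (a : gT) :
  {morph f : x y / (x * y)%g >-> x * y} -> f a != 1 -> \sum_x f x = 0.
Proof.
move=> fM fa1; apply/eqP; have : (f a - 1) * \sum_x f x = 0.
  rewrite mulrBl mul1r mulr_sumr [X in _ - X](reindex_inj (mulgI a)) /=.
  by apply/eqP; rewrite subr_eq0; apply/eqP/eq_bigr => x _; rewrite fM.
by move/eqP; rewrite mulf_eq0 subr_eq0 (negbTE fa1).
Qed.

Section Cexpi.
Variable R : realType.
Implicit Types (x y : R) (n : nat).

Lemma cexpi0 : cexpi (0 : R) = 1.
Proof. by rewrite /cexpi cos0 sin0. Qed.

Lemma cexpiD x y : cexpi (x + y) = cexpi x * cexpi y.
Proof.
by rewrite /cexpi cosD sinD; congr Complex; rewrite addrC.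
Qed.

Lemma cexpiMn x n : cexpi (x *+ n) = cexpi x ^+ n.
Proof.
by elim: n => [|n IHn]; rewrite ?mulr0n ?cexpi0 // mulrS cexpiD IHn exprS.
Qed.

Lemma cexpi_conjM x : cexpi x * (cexpi x)^* = 1.
Proof.
have -> : (cexpi x)^* = cexpi (- x) by rewrite /cexpi cosN sinN.
by rewrite -cexpiD subrr cexpi0.
Qed.

(** Half-angle argument: [cos x = 1] forces [sin (x / 2) = 0], whereas [x / 2] lies strictly between
    [0] and [pi]. *)
Lemma cexpi_neq1 x : 0 < x < pi *+ 2 -> cexpi x != 1.
Proof.
move=> /andP[x0 x2pi]; apply/eqP => /(congr1 (@complex.Re R)) /= cosx1.
have xE : x = (x / 2) *+ 2 by rewrite -mulr_natr divfK ?pnatr_eq0.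
have /sin_gt0_pi : 0 < x / 2 < pi.
  by rewrite divr_gt0 //= ltr_pdivrMr // mulr_natr.
rewrite lt0r -sqrf_eq0 sin2cos2 => /andP[/eqP + _]; apply.
move: cosx1; rewrite {1}xE cos_mulr2n => /eqP.
rewrite subr_eq -mulr2n eqr_pMn2r // => /eqP ->.
by rewrite subrr.
Qed.

Definition unity_root n : R[i] := cexpi (pi *+ 2 / n%:R).

Lemma unity_rootXn n : (0 < n)%N -> unity_root n ^+ n = 1.
Proof.
move=> n0; rewrite -cexpiMn -[_ *+ n]mulr_natr divfK ?pnatr_eq0 -?lt0n //.
by rewrite /cexpi cos2pi sin2pi.
Qed.

Lemma unity_rootX_neq1 n m : (0 < m < n)%N -> unity_root n ^+ m != 1.
Proof.
move=> /andP[m0 mn]; have n0 := ltn_trans m0 mn.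
have pi2_gt0 : 0 < (pi : R) *+ 2 by rewrite pmulrn_lgt0 ?pi_gt0.
rewrite -cexpiMn cexpi_neq1 // -[_ *+ m]mulr_natr mulr_gt0 ?divr_gt0 ?ltr0n //=.
by rewrite -mulrA gtr_pMr // mulrC ltr_pdivrMr ?ltr0n // mul1r ltr_nat.
Qed.

(** For [a <= b], cancelling the nonzero power [a] leaves a power [b - a < n] equal to [1], so
    [b - a] cannot be positive. *)
Lemma unity_rootX_inj n a b : (a < n)%N -> (b < n)%N ->
  unity_root n ^+ a = unity_root n ^+ b -> a = b.
Proof.
wlog le_ab : a b / (a <= b)%N => [wl an bn eq_ab|an bn].
  by case: (leqP a b) => [|/ltnW] le; [|symmetry]; apply: wl.
have n0 : (0 < n)%N by apply: leq_ltn_trans an.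
have z0 : unity_root n != 0.
  apply/eqP => z0; have := unity_rootXn _ n0.
  by rewrite z0 expr0n eqn0Ngt n0 => /esym/eqP; rewrite oner_eq0.
rewrite -{1}(subnKC le_ab) exprD -{1}[_ ^+ a]mulr1 => /esym.
move/(mulfI (expf_neq0 _ z0)) => zba.
apply/eqP; rewrite eqn_leq le_ab /= leqNgt; apply/negP => lt_ab.
have := @unity_rootX_neq1 n (b - a); rewrite subn_gt0 lt_ab zba eqxx.
by rewrite (leq_ltn_trans (leq_subr _ _) bn) => /(_ isT).
Qed.

End Cexpi.

Section Parseval.
Context {R : realType} {d : nat} {N : 'I_d -> nat}.
Hypothesis N_gt0 : forall j, (0 < N j)%N.
Implicit Types g h k l : prodZ N.

Lemma chiE k g : chi R k g = \prod_(j < d) unity_root R (N j) ^+ (k j * g j).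
Proof.
apply: eq_bigr => j _; rewrite -cexpiMn; congr cexpi.
by rewrite -[RHS]mulr_natr -[pi *+ 2]mulr_natl [RHS]mulrAC natrM !mulrA.
Qed.

Lemma chiM k l g : chi R (k * l)%g g = chi R k g * chi R l g.
Proof.
rewrite !chiE -big_split; apply: eq_bigr => j _ /=.
rewrite -exprD -mulnDl dffunM.
(* The group law reduces modulo [(N j).-1.+1], which is [N j] by positivity; the reduction is
   harmless in an exponent of an [N j]-th root of unity. *)
have -> : (k j * l j)%g = ((k j + l j) %% N j)%N :> nat.
  exact: (congr1 (modn (k j + l j)%N) (prednK (N_gt0 j))).
by rewrite !exprM expr_mod // unity_rootXn.
Qed.

Lemma chi_conjM k g : chi R k g * (chi R k g)^* = 1.
Proof.
by rewrite rmorph_prod -big_split big1 // => j _; rewrite /= cexpi_conjM.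
Qed.

(** When [N j = 1], [inord 1] defaults to [0] and this is the identity, whence the condition
    [1 < N j] below. *)
Definition unit_vector (j : 'I_d) : prodZ N :=
  [ffun i => if i == j then inord 1 else ord0].

Lemma chi_unit_vector j g : (1 < N j)%N ->
  chi R (unit_vector j) g = unity_root R (N j) ^+ g j.
Proof.
move=> Nj1; rewrite chiE (bigD1 j) //= big1 => [|i /negPf ij].
  by rewrite ffunE eqxx inordK ?prednK // mul1n mulr1.
by rewrite ffunE ij mul0n.
Qed.

Lemma chi_orthogonal g h :
  \sum_k chi R k g * (chi R k h)^* = (#|prodZ N| * (g == h))%:R.
Proof.
have [<-|gh] := eqVneq g h.
  by rewrite muln1 (eq_bigr _ (fun k _ => chi_conjM k g)) sumr_const.
have /existsP[j gjh] : [exists j, g j != h j].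
  apply: contraR gh => /existsPn gh; apply/eqP/ffunP => j.
  by apply/eqP/negPn.
have ltgN (g' : prodZ N) : (g' j < N j)%N.
  by apply: leq_trans (ltn_ord _) _; rewrite prednK.
(* A trivial factor could not separate [g] from [h]. *)
have Nj1 : (1 < N j)%N.
  rewrite ltnNge; apply: contraNN gjh => Nj1; apply/eqP/val_inj => /=.
  have gj0 (g' : prodZ N) : g' j = 0%N :> nat.
    by have := leq_trans (ltgN g') Nj1; rewrite ltnS leqn0 => /eqP.
  by rewrite !gj0.
rewrite muln0; apply: (@sum_multiplicative_eq0 _ _ _ (unit_vector j)).
  by move=> k l; rewrite !chiM rmorphM mulrACA.
apply: contraNN gjh => /eqP gh1; apply/eqP/val_inj => /=.
apply: (@unity_rootX_inj R (N j)) => //.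
rewrite -!chi_unit_vector //.
(* Since [chi] has modulus one, a product [chi R k g * (chi R k h)^*] equal to [1] means that the
   two character values agree. *)
rewrite -[LHS]mulr1 -(chi_conjM (unit_vector j) h) mulrCA gh1.
by rewrite mulr1.
Qed.

Context {V : finType} {phi : V -> prodZ N}.
Hypothesis phi_inj : injective phi.

Lemma lift_signal_phi (s : V -> R[i]) v : lift_signal phi s (phi v) = s v.
Proof.
rewrite /lift_signal; case: pickP => [u /eqP/phi_inj -> //|/(_ v)].
by rewrite eqxx.
Qed.

(** Off the image of [phi] the lift vanishes; on it, injectivity gives one term per vertex. *)
Lemma lift_signal_dot (s t : V -> R[i]) :
  \sum_g lift_signal phi s g * (lift_signal phi t g)^* = \sum_v s v * (t v)^*.
Proof.
rewrite (bigID (mem (phi @: V))) /= [X in _ + X]big1 => [|g]; last first.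
  rewrite /lift_signal; case: pickP => [u /eqP <-|]; last by rewrite mul0r.
  by rewrite imset_f.
rewrite addr0 big_imset /=; last by move=> ? ? _ _; apply: phi_inj.
by apply: eq_bigr => v _; rewrite !lift_signal_phi.
Qed.

Lemma gft_dot (s t : V -> R[i]) :
  \sum_k gft phi s k * (gft phi t k)^* = \sum_v s v * (t v)^*.
Proof.
pose c : R[i] := ((Num.sqrt #|prodZ N|%:R)^-1)%:C%C.
have cc : c^* = c by apply: conjc_real.
have card_gt0 : (0 < #|prodZ N|)%N by apply/card_gt0P; exists 1%g.
have c2N : c * c * #|prodZ N|%:R = 1.
  rewrite -[#|prodZ N|%:R](rmorph_nat (real_complex R)) -!rmorphM /=.
  by rewrite -expr2 exprVn sqr_sqrtr ?ler0n // mulVf ?pnatr_eq0 -?lt0n.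
pose s' := lift_signal phi s; pose t' := lift_signal phi t.
have gftE k : gft phi s k * (gft phi t k)^* =
    \sum_g \sum_h c * c * (s' g * (t' h)^*) * (chi R k h * (chi R k g)^*).
  rewrite /gft -/c rmorphM /= cc rmorph_sum mulrACA mulr_suml mulr_sumr.
  apply: eq_bigr => g _; rewrite mulr_sumr mulr_sumr; apply: eq_bigr => h _.
  rewrite rmorphM /= conjCK -!mulrA; congr (_ * (_ * (_ * _))).
  by rewrite mulrCA [_ * chi _ _ _]mulrC.
(* With the sum over [k] innermost, orthogonality keeps only [h = g], and its factor [#|prodZ N|]
   cancels [c * c]. *)
rewrite (eq_bigr _ (fun k _ => gftE k)) exchange_big -lift_signal_dot.
apply: eq_bigr => g _; rewrite exchange_big (bigD1 g) //=.
rewrite [X in _ + X]big1 => [|h /negPf hg].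
  by rewrite /= -mulr_sumr chi_orthogonal eqxx muln1 addr0 mulrAC c2N mul1r.
by rewrite /= -mulr_sumr chi_orthogonal hg muln0 mulr0.
Qed.

End Parseval.

Lemma l2norm_sqr (R : realType) (T : finType) (f : T -> R[i]) :
  ((l2norm f) ^+ 2)%:C%C = \sum_x f x * (f x)^*.
Proof.
rewrite /l2norm sqr_sqrtr ?sumr_ge0 // => [|x _]; last exact: sqr_ge0.
rewrite rmorph_sum; apply: eq_bigr => x _.
by rewrite -normCK rmorphXn.
Qed.

Theorem theorem5p4 (R : realType)
    (V : finType) (e : rel V) (He : is_graph e) (Hconn : graph_connected e)
    (d : nat) (N : 'I_d -> nat) (HN : forall j, (0 < N j)%N)
    (S : {set prodZ N}) (HS : is_connection_set S)
    (phi : V -> prodZ N) (Hphi : isometric e (cayley S) phi) :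
  (forall s t : V -> R[i],
     \sum_(v : V) s v * (t v)^* = \sum_(k : prodZ N) gft phi s k * (gft phi t k)^*)
  /\ (forall s : V -> R[i], l2norm s = l2norm (gft phi s)).
Proof.
have phi_inj := isometric_inj _ _ _ _ _ Hphi.
split=> [s t|s]; first by rewrite gft_dot.
(* Norms are nonnegative, so it suffices to compare squares, which are Hermitian products once
   embedded in [R[i]]. *)
apply/eqP; rewrite -(@eqrXn2 _ 2) ?sqrtr_ge0 //; apply/eqP.
apply: (@complexI R); rewrite [LHS]l2norm_sqr [RHS]l2norm_sqr.
by rewrite gft_dot.
Qed.
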